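(* Let $L/K$ be a finite Galois extension of fields whose Galois group $(G,\circ)$ is the semidirect product of a normal subgroup $(A,\circ)$ and a subgroup $(B,\circ)$. Let $X=G/B$ be the left coset space of $B$ in $(G,\circ)$. Suppose we are given a Hopf-Galois structure on $L^{B}/K$, with corresponding regular subgroup $M \leq \mathrm{Perm}(X)$, and a Hopf-Galois structure on the extension $L/L^{B}$, with corresponding regular subgroup $N \leq \mathrm{Perm}(B)$. Let $(B,\cdot,\circ)$ be the skew brace corresponding to $N \leq \mathrm{Perm}(B)$. Then there is a skew brace $(A,\cdot,\circ)$ such that $\rho_{\cdot}(A) = \psi(M)$, the skew brace $A \rtimes^{\varphi}_{\mathrm{id}} B$ is defined, and the corresponding Hopf-Galois structure on $L/K$ coincides with that induced from $M$ and $N$.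
   Context: Skew braces. A (left) skew brace is a triple $(G,\cdot,\circ)$ in which $(G,\cdot)$ and $(G,\circ)$ are groups with $x \circ (y \cdot z) = (x \circ y) \cdot x^{-1} \cdot (x \circ z)$ for all $x,y,z$, where $x^{-1}$ is the inverse for $\cdot$; $\bar{x}$ is the inverse for $\circ$, and $e$ is the common identity. $\rho_\cdot$ is the right regular representation for $\cdot$: $\rho_\cdot(x)[y]=y\cdot x^{-1}$. $\lambda_\circ$ is the left regular representation for $\circ$. Hopf-Galois structures. A $K$-Hopf algebra $H$ gives a Hopf-Galois structure on $L/K$ if $L$ is an $H$-module algebra and the natural map $L \otimes_K H \to \mathrm{End}_K(L)$, $x\otimes h\mapsto (y\mapsto x\,h(y))$, is an isomorphism; two such are identified if there is a Hopf algebra isomorphism compatible with the actions. Greither-Pareigis correspondence. Let $L/K$ be Galois with group $(G,\circ)$, $C\le (G,\circ)$ a subgroup, $Y=G/C$ the left coset space and $\lambda_Y : G \to \mathrm{Perm}(Y)$ left translation. Hopf-Galois structures on $L^C/K$ correspond bijectively with regular subgroups $N\le \mathrm{Perm}(Y)$ (transitive with trivial point stabilisers) normalised by $\lambda_Y(G)$: to $N$ corresponds the Hopf algebra $L[N]^{G}$, where $g \in G$ acts on $L$ by Galois automorphisms and on $N$ by conjugation by $\lambda_Y(g)$, acting on $t\in L^C$ by $(\sum_{\eta} c_\eta \eta)[t]=\sum_\eta c_\eta\, (\eta^{-1}[eC])[t]$. This is used with $C$ trivial (so $Y=G$) for $L/K$, with $C=B$ (so $Y=X$) for $L^B/K$,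 and for the Galois extension $L/L^B$ with group $(B,\circ)$, giving regular subgroups of $\mathrm{Perm}(B)$ normalised by $\lambda_\circ(B)$. Relation with skew braces. If $(G,\cdot,\circ)$ is a skew brace then $\rho_\cdot(G)$ is a regular subgroup of $\mathrm{Perm}(G)$ normalised by $\lambda_\circ(G)$; conversely, given such a subgroup $N$, transporting its structure along the bijection $N\to G$, $\eta\mapsto \eta^{-1}[e]$, gives an operation $\cdot$ on $G$ such that $(G,\cdot,\circ)$ is a skew brace and $N=\rho_\cdot(G)$. The Hopf-Galois structure corresponding to the skew brace $(G,\cdot,\circ)$ is the one corresponding to $\rho_\cdot(G)$. The same applies to $(B,\circ)$ and $L/L^B$. Induced structures. Define the group isomorphism $\psi:\mathrm{Perm}(X)\to \mathrm{Perm}(A)$ by $\psi(\mu)[a]\circ B=\mu[a\circ B]$ for $a\in A$. The Hopf-Galois structure on $L/K$ induced from $M$ and $N$ is the one corresponding to the regular subgroup $\nu(M\times N)\le \mathrm{Perm}(G)$, where $\nu(\mu,\eta)[a\circ b]=\psi(\mu)[a]\circ\eta[b]$ for $a\in A$, $b\in B$. The product. $\varphi:(B,\circ)\to\mathrm{Aut}(A,\circ)$ is $\varphi_b(a)=b\circ a\circ\bar{b}$. For skew braces $(A,\cdot,\circ)$ and $(B,\cdot,\circ)$, $A\rtimes^{\varphi}_{\mathrm{id}}B$ is $A\times B$ with $(a,b)\circ(a',b')=(a\circ\varphi_b(a'),b\circ b')$ and $(a,b)\cdot(a',b')=(a\cdot a',b\cdot b')$; saying that it ''is defined'' means that every $\varphi_b$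 respects $\cdot$ as well as $\circ$ on $A$ (i.e. the skew brace $B$ acts on the skew brace $A$ via $\varphi$), and hence that $A\rtimes^{\varphi}_{\mathrm{id}}B$ is a skew brace. It is regarded as a skew brace structure on the set $G$, with the given operation $\circ$, via the identification $(a,b)\leftrightarrow a\circ b$. *)

(* Defs.v *)
From HB Require Import structures.
From mathcomp Require Import all_boot all_order all_algebra all_fingroup all_solvable all_field.

Set Implicit Arguments.
Unset Strict Implicit.
Unset Printing Implicit Defensive.

Import GRing.Theory.
Local Open Scope ring_scope.

(* U (x) V in the coordinates given by the bases [vbasis] of U and V. *)
Definition tensor (F : fieldType) (U V : vectType F) :=
  'M[F]_(\dim {:U}, \dim {:V}).

Definition tens (F : fieldType) (U V : vectType F) (u : U) (v : V) :
    tensor U V :=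
  \matrix_(i, j) (coord (vbasis {:U}) i u * coord (vbasis {:V}) j v).

(* The linear map U (x) V -> W induced by a bilinear map beta; see [tliftE]. *)
Definition tlift (F : fieldType) (U V : vectType F) (W : lmodType F)
    (beta : U -> V -> W) (t : tensor U V) : W :=
  \sum_i \sum_j t i j *: beta (vbasis {:U})`_i (vbasis {:V})`_j.

Lemma tliftE (F : fieldType) (U V : vectType F) (W : lmodType F)
    (beta : U -> V -> W) u v :
  (forall x, linear (beta x)) -> (forall y, linear (beta^~ y)) ->
  tlift beta (tens u v) = beta u v.
Proof.
move=> linR linL; rewrite /tlift.
pose bR x : {linear V -> W} :=
  HB.pack (beta x) (GRing.isLinear.Build _ _ _ _ _ (linR x)).
pose bL y : {linear U -> W} :=
  HB.pack (beta^~ y) (GRing.isLinear.Build _ _ _ _ _ (linL y)).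
rewrite [in RHS](coord_vbasis (memvf u)) -[RHS]/(bL v _) linear_sum.
apply: eq_bigr => i _; rewrite linearZ /= [in RHS](coord_vbasis (memvf v)).
rewrite -[X in _ *: X]/(bR _ _) linear_sum scaler_sumr.
by apply: eq_bigr => j _; rewrite linearZ scalerA mxE.
Qed.

Lemma tlift_linear (F : fieldType) (U V : vectType F) (W : lmodType F)
    (beta : U -> V -> W) : linear (tlift beta).
Proof.
move=> a s t; rewrite /tlift scaler_sumr -big_split; apply: eq_bigr => i _ /=.
rewrite scaler_sumr -big_split; apply: eq_bigr => j _ /=.
by rewrite !mxE scalerDl scalerA.
Qed.

Definition tmul (F : fieldType) (H : falgType F) (s t : tensor H H) :
    tensor H H :=
  tlift (fun x y => tlift (fun x' y' => tens (x * x') (y * y')) t) s.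

(* Finite-dimensionality is no restriction: the isomorphism
   L (x) H -> End_K(L) forces it when L/K is finite. *)
Record hopfAlg (F : fieldType) := HopfAlg {
  ha_alg :> falgType F;
  comul : {linear ha_alg -> tensor ha_alg ha_alg};
  counit : {linear ha_alg -> F^o};
  antip : {linear ha_alg -> ha_alg};
  comul1 : comul 1 = tens 1 1;
  comulM : forall h k, comul (h * k) = tmul (comul h) (comul k);
  counit1 : counit 1 = 1;
  counitM : forall h k, counit (h * k) = counit h * counit k;
  coassoc : forall h,
    tlift (fun x y => tens (comul x) y) (comul h) =
    tlift (fun x y => tlift (fun y1 y2 => tens (tens x y1) y2) (comul y))
      (comul h);
  counitl : forall h, tlift (fun x y => counit x *: y) (comul h) = h;
  counitr : forall h, tlift (fun x y => counit y *: x) (comul h) = h;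
  antipl : forall h, tlift (fun x y => antip x * y) (comul h) = (counit h)%:A;
  antipr : forall h, tlift (fun x y => x * antip y) (comul h) = (counit h)%:A
}.

Arguments comul {F _}.
Arguments counit {F _}.
Arguments antip {F _}.

Record hopf_galois (F : fieldType) (E : fieldExtType F) := HopfGalois {
  hg_alg :> hopfAlg F;
  hg_act : hg_alg -> {linear E -> E};
  hg_act_linear : forall (a : F) h k t,
    hg_act (a *: h + k) t = a *: hg_act h t + hg_act k t;
  hg_act1 : forall t, hg_act 1 t = t;
  hg_actM : forall h k t, hg_act (h * k) t = hg_act h (hg_act k t);
  hg_act_unit : forall h, hg_act h 1 = (counit h)%:A;
  hg_act_prod : forall h s t,
    hg_act h (s * t) =
    tlift (fun h1 h2 => hg_act h1 s * hg_act h2 t) (comul h);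
  hg_galois : bijective (fun w : tensor E hg_alg =>
    linfun (fun t : E => tlift (fun x h => x * hg_act h t) w) : 'End(E))
}.

Arguments hg_act {F E _}.

Definition hopf_galois_iso (F : fieldType) (E : fieldExtType F)
    (H H' : hopf_galois E) : Prop :=
  exists f : {lrmorphism H -> H'},
    [/\ bijective f,
        forall h, comul (f h) = tlift (fun x y => tens (f x) (f y)) (comul h),
        forall h, counit (f h) = counit h,
        forall h, antip (f h) = f (antip h)
      & forall h t, hg_act (f h) t = hg_act h t].

(* Products in [gal_of] are composed from left to right, so an identification
   of a group G (with maps composed from right to left) with Gal(L/K) reverses
   the products of mathcomp. *)
Definition galois_ident (K : fieldType) (L : splittingFieldType K)
    (gT : finGroupType) (sigma : gT -> gal_of {:L}) : Prop :=
  [/\ injective sigma,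
      sigma @: [set: gT] = 'Gal({:L} / 1%AS)%g
    & forall (g h : gT) (x : L), sigma (g * h)%g x = sigma g (sigma h x)].

Definition fixed_by (K : fieldType) (L : splittingFieldType K)
    (gT : finGroupType) (sigma : gT -> gal_of {:L}) (B : {set gT}) :
    {subfield L} :=
  fixedField_aspace (sigma @: B).

Definition regular_subgroup (Y : finType) (N : {set {perm Y}}) : Prop :=
  [transitive N, on [set: Y] | 'P] /\
  forall y, ('C_N[y | 'P] = 1 :> {set {perm Y}})%g.

Definition normalised_by (gT : finGroupType) (Y : finType)
    (lam : gT -> {perm Y}) (N : {set {perm Y}}) : Prop :=
  forall g, lam g \in 'N(N)%g.

Definition left_reg (gT : finGroupType) (g : gT) : {perm gT} :=
  perm (@mulgI gT g).

Definition lcoset_space (gT : finGroupType) (B : {set gT}) :=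
  {c : {set gT} | c \in lcosets B [set: gT]}.

Section LeftCosets.
Local Open Scope group_scope.
Variables (gT : finGroupType) (B : {set gT}).

Lemma lcoset_of_subproof (g : gT) : g *: B \in lcosets B [set: gT].
Proof. by apply/lcosetsP; exists g; rewrite ?inE. Qed.

Definition lcoset_of (g : gT) : lcoset_space B :=
  exist _ (g *: B) (lcoset_of_subproof g).

Lemma lcoset_transl_subproof (g : gT) (c : lcoset_space B) :
  g *: val c \in lcosets B [set: gT].
Proof.
case: c => c /= /lcosetsP[x _ ->]; rewrite -lcosetM; exact: lcoset_of_subproof.
Qed.

Definition lcoset_transl (g : gT) (c : lcoset_space B) : lcoset_space B :=
  exist _ (g *: val c) (lcoset_transl_subproof g c).

Lemma lcoset_transl_inj g : injective (lcoset_transl g).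
Proof. by move=> c d /(congr1 val)/lcoset_inj/val_inj. Qed.

Definition lcoset_reg (g : gT) : {perm lcoset_space B} :=
  perm (@lcoset_transl_inj g).

End LeftCosets.

Section GreitherPareigis.
(* A group G acts on the field L (by [act]) and on Y (by [lam]), and Y is
   identified with G/C, the base point y0 being the coset eC; E is a copy of
   L^C, included in L by [incl], and [ev y t] is the image in L of t in E under
   (any element of) the coset y. The group ring L[N] is represented by the
   functions Perm(Y) -> L supported in N. *)
Variables (F : fieldType) (L E : fieldExtType F) (incl : E -> L).
Variables (gT : finGroupType) (act : gT -> L -> L).
Variables (Y : finType) (lam : gT -> {perm Y}) (y0 : Y) (ev : Y -> E -> L).

(* The elements of L[N]^G. Since permutations are composed from left to right,
   eta ^ lam g is the map lam g o eta o (lam g)^-1. *)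
Definition gp_invariant (N : {set {perm Y}}) (c : {ffun {perm Y} -> L}) : Prop :=
  (forall eta, eta \notin N -> c eta = 0) /\
  (forall g eta, act g (c eta) = c (eta ^ lam g)%g).

(* The product of L[Perm(Y)]: the map eta o theta is (theta * eta)%g. *)
Definition gp_mul (c d : {ffun {perm Y} -> L}) : {ffun {perm Y} -> L} :=
  [ffun p => \sum_eta \sum_(theta | (theta * eta)%g == p) c eta * d theta].

(* The comultiplication eta |-> eta (x) eta is computed in
   L[N] (x)_L L[N] = L[N x N]. *)
Definition gp_corresponds (H : hopf_galois E) (N : {set {perm Y}}) : Prop :=
  exists Phi : {linear H -> {ffun {perm Y} -> L}},
    [/\ injective Phi,
        forall c, (exists h, Phi h = c) <-> gp_invariant N c
      & [/\ Phi 1 = [ffun eta => (eta == 1%g)%:R],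
            forall h k, Phi (h * k) = gp_mul (Phi h) (Phi k),
            forall h,
              tlift (fun x y => [ffun p : {perm Y} * {perm Y} =>
                                   Phi x p.1 * Phi y p.2]) (comul h) =
              [ffun p => if p.1 == p.2 then Phi h p.1 else 0],
            forall h, (counit h)%:A = \sum_eta Phi h eta
          & forall h eta, Phi (antip h) eta = Phi h (eta^-1)%g] /\
        forall h t,
          incl (hg_act h t) = \sum_eta Phi h eta * ev ((eta^-1)%g y0) t].

End GreitherPareigis.

Section GaloisCases.
Variables (K : fieldType) (L : splittingFieldType K).
Variables (gT : finGroupType) (sigma : gT -> gal_of {:L}) (B : {group gT}).

Let LB := fixed_by sigma B.

(* L/K, with Y = G *)
Definition gp_full (H : hopf_galois (L : fieldExtType K))
    (N : {set {perm gT}}) : Prop :=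
  @gp_corresponds K L L id gT (fun g x => sigma g x) gT (@left_reg gT) 1%g
    (fun g x => sigma g x) H N.

(* L^B/K, with Y = G/B *)
Definition gp_fixed (H : hopf_galois (subvs_of LB : fieldExtType K))
    (N : {set {perm lcoset_space B}}) : Prop :=
  @gp_corresponds K L (subvs_of LB) vsval gT (fun g x => sigma g x)
    (lcoset_space B) (@lcoset_reg gT B) (lcoset_of B 1%g)
    (fun c t => sigma (repr (val c)) (vsval t)) H N.

(* L/L^B, with group B and Y = B *)
Definition gp_over (H : hopf_galois (fieldOver LB))
    (N : {set {perm subg_of B}}) : Prop :=
  @gp_corresponds (subvs_of LB) (fieldOver LB) (fieldOver LB) id
    (subg_of B) (fun b (x : L) => sigma (sgval b) x)
    (subg_of B) (@left_reg (subg_of B)) 1%g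
    (fun b (x : L) => sigma (sgval b) x) H N.

End GaloisCases.

Record group_str (T : Type) := GroupStr {
  gop :> T -> T -> T;
  gid : T;
  ginv : T -> T;
  gopA : associative gop;
  gop1l : left_id gid gop;
  gopVl : left_inverse gid ginv gop
}.

Record skew_brace (T : Type) := SkewBrace {
  sdot : group_str T;
  scirc : group_str T;
  skew_braceP : forall x y z,
    scirc x (sdot y z) = sdot (sdot (scirc x y) (ginv sdot x)) (scirc x z)
}.

Section GroupStr.
Variables (T : Type) (S : group_str T).

Lemma gopVr x : S x (ginv S x) = gid S.
Proof.
rewrite -[LHS](gop1l S) -{1}(gopVl S (ginv S x)) -gopA.
by rewrite (gopA S (ginv S x) x) gopVl gop1l gopVl.
Qed.

Lemma gop1r x : S x (gid S) = x.
Proof. by rewrite -(gopVl S x) gopA gopVr gop1l. Qed.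

Lemma gopI x : injective (S x).
Proof. by move=> y z /(congr1 (S (ginv S x))); rewrite !gopA gopVl !gop1l. Qed.

Lemma gopIr x : injective (S^~ x).
Proof.
by move=> y z /= /(congr1 (S^~ (ginv S x))); rewrite -!gopA gopVr !gop1r.
Qed.

End GroupStr.

Definition circ_given (gT : finGroupType) (S : skew_brace gT) : Prop :=
  forall x y, scirc S x y = (x * y)%g.

Definition rho_dot (T : finType) (S : skew_brace T) (x : T) : {perm T} :=
  perm (@gopIr T (sdot S) (ginv (sdot S) x)).

Definition rho_set (T : finType) (S : skew_brace T) : {set {perm T}} :=
  rho_dot S @: [set: T].

Definition brace_of (gT : finGroupType) (N : {set {perm gT}})
    (S : skew_brace gT) : Prop :=
  circ_given S /\ rho_set S = N.

Section Product.
Variables (T U : Type) (SA : skew_brace T) (SB : skew_brace U).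
Variable phi : U -> T -> T.

Record brace_acts : Prop := BraceActs {
  acts_comp : forall b c a, phi (scirc SB b c) a = phi b (phi c a);
  acts_bij : forall b, bijective (phi b);
  acts_circ : forall b, {morph phi b : x y / scirc SA x y};
  acts_dot : forall b, {morph phi b : x y / sdot SA x y}
}.

Definition prod_dot_op (p q : T * U) : T * U :=
  (sdot SA p.1 q.1, sdot SB p.2 q.2).

Lemma prod_dotA : associative prod_dot_op.
Proof. by case=> ? ? [? ?] [? ?]; rewrite /prod_dot_op /= !gopA. Qed.
Lemma prod_dot1 : left_id (gid (sdot SA), gid (sdot SB)) prod_dot_op.
Proof. by case=> ? ?; rewrite /prod_dot_op /= !gop1l. Qed.
Lemma prod_dotV : left_inverse (gid (sdot SA), gid (sdot SB))
  (fun p => (ginv (sdot SA) p.1, ginv (sdot SB) p.2)) prod_dot_op.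
Proof. by case=> ? ?; rewrite /prod_dot_op /= !gopVl. Qed.

Hypothesis act : brace_acts.

Definition sdprod_circ_op (p q : T * U) : T * U :=
  (scirc SA p.1 (phi p.2 q.1), scirc SB p.2 q.2).

Lemma acts_id a : phi (gid (scirc SB)) a = a.
Proof.
have [inv phiK _] := acts_bij act (gid (scirc SB)).
by rewrite -[RHS]phiK -[in RHS](gop1l (scirc SB) (gid (scirc SB)))
   (acts_comp act) phiK.
Qed.

Lemma acts_gid b : phi b (gid (scirc SA)) = gid (scirc SA).
Proof.
by apply: (@gopI _ (scirc SA) (phi b (gid (scirc SA))));
   rewrite -(acts_circ act) gop1l gop1r.
Qed.

Lemma sdprod_circA : associative sdprod_circ_op.
Proof.
case=> ? ? [? ?] [? ?]; rewrite /sdprod_circ_op /=.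
by rewrite !gopA (acts_circ act) (acts_comp act) gopA.
Qed.
Lemma sdprod_circ1 : left_id (gid (scirc SA), gid (scirc SB)) sdprod_circ_op.
Proof. by case=> ? ?; rewrite /sdprod_circ_op /= acts_id !gop1l. Qed.
Lemma sdprod_circV : left_inverse (gid (scirc SA), gid (scirc SB))
  (fun p => (phi (ginv (scirc SB) p.2) (ginv (scirc SA) p.1),
             ginv (scirc SB) p.2)) sdprod_circ_op.
Proof.
by case=> ? ?; rewrite /sdprod_circ_op /= -(acts_circ act) !gopVl acts_gid.
Qed.

Lemma sdprod_braceP p q r :
  sdprod_circ_op p (prod_dot_op q r) =
  prod_dot_op (prod_dot_op (sdprod_circ_op p q)
    (ginv (sdot SA) p.1, ginv (sdot SB) p.2)) (sdprod_circ_op p r).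
Proof.
by rewrite /sdprod_circ_op /prod_dot_op /= (acts_dot act) !skew_braceP.
Qed.

Definition sdprod_brace : skew_brace (T * U) :=
  @SkewBrace (T * U) (GroupStr prod_dotA prod_dot1 prod_dotV)
    (GroupStr sdprod_circA sdprod_circ1 sdprod_circV) sdprod_braceP.

End Product.

Section Transport.
Variables (T U : Type) (f : T -> U) (g : U -> T).
Hypotheses (fK : cancel f g) (gK : cancel g f).

Section GroupTransport.
Variable S : group_str T.
Let op x y := f (S (g x) (g y)).
Lemma transport_opA : associative op.
Proof. by move=> x y z; rewrite /op !fK gopA. Qed.
Lemma transport_op1 : left_id (f (gid S)) op.
Proof. by move=> x; rewrite /op fK gop1l gK. Qed.
Lemma transport_opV : left_inverse (f (gid S)) (fun x => f (ginv S (g x))) op.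
Proof. by move=> x; rewrite /op fK gopVl. Qed.
Definition transport_group : group_str U :=
  GroupStr transport_opA transport_op1 transport_opV.
End GroupTransport.

Variable S : skew_brace T.
Lemma transport_braceP x y z :
  transport_group (scirc S) x (transport_group (sdot S) y z) =
  transport_group (sdot S)
    (transport_group (sdot S) (transport_group (scirc S) x y)
       (ginv (transport_group (sdot S)) x))
    (transport_group (scirc S) x z).
Proof. by rewrite /= !fK skew_braceP. Qed.
Definition transport_brace : skew_brace U := SkewBrace transport_braceP.
End Transport.

Section Semidirect.
Local Open Scope group_scope.
Variables (gT : finGroupType) (A B : {group gT}).
Hypothesis sd : A ><| B = [set: gT].

Definition ab_mul (p : subg_of A * subg_of B) : gT := sgval p.1 * sgval p.2.

Definition ab_split (g : gT) : subg_of A * subg_of B :=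
  (subg A (divgr A B g), subg B (remgr A B g)).

Lemma mem_AB g : g \in A * B.
Proof. by have [_ -> _ _] := sdprodP sd; rewrite inE. Qed.

Lemma ab_mulK : cancel ab_mul ab_split.
Proof.
have [_ _ _ tiAB] := sdprodP sd.
case=> a b; rewrite /ab_split /ab_mul /=.
by rewrite (divgrMid tiAB) ?(remgrMid tiAB) ?subgP // !sgvalK.
Qed.

Lemma ab_splitK : cancel ab_split ab_mul.
Proof.
move=> g; rewrite /ab_split /ab_mul /= !subgK -?divgr_eq //.
  by rewrite mem_remgr ?mem_AB.
by rewrite mem_divgr ?mem_AB.
Qed.

Definition a_coset (a : subg_of A) : lcoset_space B := lcoset_of B (sgval a).
Definition coset_a (c : lcoset_space B) : subg_of A := (ab_split (repr (val c))).1.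

Lemma coset_aK : cancel coset_a a_coset.
Proof.
case=> c cP; apply: val_inj; rewrite /= /coset_a /=.
have /lcosetsP[x _ Dc] := cP.
have Dy: c = repr c *: B.
  by rewrite {1}Dc; apply: lcoset_eqP; rewrite lcoset_sym Dc (mem_repr x)
     ?lcoset_refl.
rewrite [RHS]Dy -[in RHS](ab_splitK (repr c)) /ab_mul lcosetM.
by rewrite (lcoset_id (subgP _)).
Qed.

Lemma a_cosetK : cancel a_coset coset_a.
Proof.
move=> a; have [_ _ _ tiAB] := sdprodP sd; rewrite /coset_a /=.
have /lcosetP[b Bb ->]: repr (sgval a *: B) \in sgval a *: B.
  by rewrite (mem_repr (sgval a)) ?lcoset_refl.
by rewrite (divgrMid tiAB) ?subgP // sgvalK.
Qed.

Lemma psi_subproof (mu : {perm lcoset_space B}) :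
  injective (fun a : subg_of A => coset_a (mu (a_coset a))).
Proof.
by move=> a a' /(can_inj coset_aK)/perm_inj/(can_inj a_cosetK).
Qed.

Definition psi (mu : {perm lcoset_space B}) : {perm subg_of A} :=
  perm (@psi_subproof mu).

Lemma psiE (mu : {perm lcoset_space B}) (a : subg_of A) :
  lcoset_of B (sgval (psi mu a)) = mu (lcoset_of B (sgval a)).
Proof. by rewrite permE -[LHS]/(a_coset _) coset_aK. Qed.

Definition nu_fun (mu : {perm lcoset_space B}) (eta : {perm subg_of B})
    (g : gT) : gT :=
  sgval (psi mu (ab_split g).1) * sgval (eta (ab_split g).2).

Lemma nu_subproof mu eta : injective (nu_fun mu eta).
Proof.
move=> g h eq_gh; apply: (can_inj ab_splitK).
have: (psi mu (ab_split g).1, eta (ab_split g).2) =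
      (psi mu (ab_split h).1, eta (ab_split h).2).
  exact: (can_inj ab_mulK).
case=> /perm_inj eq1 /perm_inj eq2.
by rewrite /ab_split eq1 eq2.
Qed.

Definition nu mu eta : {perm gT} := perm (@nu_subproof mu eta).

Lemma nuE mu eta (a : subg_of A) (b : subg_of B) :
  nu mu eta (sgval a * sgval b) = sgval (psi mu a) * sgval (eta b).
Proof. by rewrite permE /nu_fun -[_ * sgval b]/(ab_mul (a, b)) ab_mulK. Qed.

Definition nu_set (M : {set {perm lcoset_space B}}) (N : {set {perm subg_of B}}) :
    {set {perm gT}} :=
  [set nu mu eta | mu in M, eta in N].

(* phi_b(a) = b o a o b^-1, which lies in A because A is normal *)
Definition phi_conj (b : subg_of B) (a : subg_of A) : subg_of A :=
  subg A (sgval b * sgval a * (sgval b)^-1).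

Lemma phi_conjE b a : sgval (phi_conj b a) = sgval b * sgval a * (sgval b)^-1.
Proof.
have [_ _ nAB _] := sdprodP sd; rewrite subgK // -[_ * _^-1]mulgA.
have ->: sgval b * (sgval a * (sgval b)^-1) = sgval a ^ (sgval b)^-1.
  by rewrite conjgE invgK mulgA.
by rewrite memJ_norm ?subgP // groupV (subsetP nAB) ?subgP.
Qed.

Definition brace_on_G (SA : skew_brace (subg_of A)) (SB : skew_brace (subg_of B))
    (act : brace_acts SA SB phi_conj) : skew_brace gT :=
  transport_brace ab_mulK ab_splitK (sdprod_brace act).

Lemma brace_on_G_circ SA SB (act : brace_acts SA SB phi_conj) :
  circ_given SA -> circ_given SB -> circ_given (brace_on_G act).
Proof.
move=> cA cB g h; rewrite -[in RHS](ab_splitK g) -[in RHS](ab_splitK h).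
set p := ab_split g; set q := ab_split h.
rewrite /= /ab_mul /= cA cB /= !(phi_conjE) -/p -/q.
by rewrite !mulgA mulgKV.
Qed.

End Semidirect.

Definition hgs_of_brace (K : fieldType) (L : splittingFieldType K)
    (gT : finGroupType) (sigma : gT -> gal_of {:L}) (S : skew_brace gT)
    (H : hopf_galois (L : fieldExtType K)) : Prop :=
  gp_full sigma H (rho_set S).

Definition hgs_induced (K : fieldType) (L : splittingFieldType K)
    (gT : finGroupType) (sigma : gT -> gal_of {:L}) (A B : {group gT})
    (sd : (A ><| B = [set: gT])%g) (M : {set {perm lcoset_space B}})
    (N : {set {perm subg_of B}}) (H : hopf_galois (L : fieldExtType K)) : Prop :=
  gp_full sigma H (nu_set sd M N).

(* Main.v *)
From HB Require Import structures.
Require Import Defs.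
From mathcomp Require Import all_boot all_order all_algebra all_fingroup all_solvable all_field.

(* M is normalised by the translations by elements of A and of B. On the copy
   psi(M) of M in Perm(A), a translation by A becomes a left translation, so
   psi(M) = rho(A) for some skew brace structure on A; a translation by b in B
   becomes phi_b, which fixes the identity and normalises rho(A), and therefore
   respects the dot operation. Then rho(A x B) = nu(M x N) is a direct
   computation, and a Hopf-Galois structure is determined up to isomorphism by
   its regular subgroup: everything transports along L[N]^G, the comultiplication
   because L[N]^G (x)_K L[N]^G embeds in L[N x N] by Galois descent. *)

Set Implicit Arguments.
Unset Strict Implicit.
Unset Printing Implicit Defensive.

Import GRing.Theory.

(** * Regular subgroups and skew braces *)

Section Groups.
Local Open Scope group_scope.

Lemma regular_subgroup_inj (Y : finType) (N : {group {perm Y}}) (y : Y) :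
  regular_subgroup N -> {in N &, injective (fun p : {perm Y} => p y)}.
Proof.
move=> [_ /(_ y) stabN] p q Np Nq eq_y; apply/eqP; rewrite eq_mulgV1.
have: p * q^-1 \in 'C_N[y | 'P].
  rewrite inE groupMl // groupV Nq; apply/astab1P.
  by rewrite /= apermE permM eq_y permK.
by rewrite stabN inE.
Qed.

Lemma regular_subgroup_onto (Y : finType) (N : {group {perm Y}}) (y z : Y) :
  regular_subgroup N -> exists2 p : {perm Y}, p \in N & p y = z.
Proof.
by move=> [trN _]; have [||p Np ->] := atransP2 trN (x := y) (y := z);
   rewrite ?inE //; exists p.
Qed.

Lemma rho_dotE (T : finType) (S : skew_brace T) (x y : T) :
  rho_dot S x y = sdot S y (ginv (sdot S) x).
Proof. by rewrite permE. Qed.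

Lemma gop_idem (T : Type) (S : group_str T) (x : T) : S x x = x -> x = gid S.
Proof. by move=> xx; apply: (@gopI _ S x); rewrite gop1r. Qed.

Lemma ginv_uniq (T : Type) (S : group_str T) (x y : T) :
  S x y = gid S -> x = ginv S y.
Proof. by move=> xy; apply: (@gopIr _ S y); rewrite /= gopVl. Qed.

Lemma ginvK (T : Type) (S : group_str T) : involutive (ginv S).
Proof. by move=> x; rewrite -(ginv_uniq (gopVr S x)). Qed.

Lemma ginv_id (T : Type) (S : group_str T) : ginv S (gid S) = gid S.
Proof. by rewrite -[RHS](gopVl S (gid S)) gop1r. Qed.

(** The brace law at the circle identity e, with both other arguments the dot identity 1, reads 1 =
    e^-1 for the dot inverse. *)
Lemma skew_brace_gid (T : Type) (S : skew_brace T) :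
  gid (scirc S) = gid (sdot S).
Proof.
have := skew_braceP S (gid (scirc S)) (gid (sdot S)) (gid (sdot S)).
by rewrite !(gop1l, gop1r) => e1; rewrite -[LHS](ginvK (sdot S)) -e1 ginv_id.
Qed.

Lemma circ_given_gid (gT : finGroupType) (S : skew_brace gT) :
  circ_given S -> gid (sdot S) = 1.
Proof.
by move=> cS; rewrite -skew_brace_gid; apply/esym/gop_idem; rewrite cS mulg1.
Qed.

(* [theta x] is the element of N sending 1 to x, and y . x = theta x y. *)
Lemma regular_subgroup_brace (gT : finGroupType) (N : {group {perm gT}}) :
    regular_subgroup N -> normalised_by (@left_reg gT) N ->
  exists S : skew_brace gT, brace_of N S.
Proof.
move=> regN normN.
have injN (y : gT) := @regular_subgroup_inj _ N y regN.
have ex_theta (x : gT) : exists p : {perm gT}, (p \in N) && (p 1 == x).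
  have [p Np p1] := regular_subgroup_onto 1 x regN.
  by exists p; rewrite Np p1 eqxx.
pose theta x := xchoose (ex_theta x).
have /all_and2[thN th1] (x : gT) : theta x \in N /\ theta x 1 = x.
  by have /andP[Np /eqP p1] := xchooseP (ex_theta x).
have thP (p : {perm gT}) : p \in N -> theta (p 1) = p.
  by move=> Np; apply: (injN 1); rewrite ?th1.
(* Composition is from left to right: [theta y * theta x] sends 1 to [y] and then to [theta x y]. *)
have thM (x y : gT) : theta (theta x y) = theta y * theta x.
  by rewrite -[RHS]thP ?groupM // permM th1.
pose op (y x : gT) : gT := theta x y.
pose inv (x : gT) : gT := (theta x)^-1 1.
have opA : associative op by move=> z y x; rewrite /op thM permM.
have op1 : left_id (1 : gT) op by move=> x; apply: th1.
have thV (x : gT) : theta (inv x) = (theta x)^-1 by rewrite thP ?groupV.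
have opV : left_inverse (1 : gT) inv op by move=> x; rewrite /op permKV.
have lamE (x y : gT) : left_reg x y = x * y by rewrite permE.
pose dotS : group_str gT := GroupStr opA op1 opV.
pose circS : group_str gT := GroupStr (@mulgA gT) (@mul1g gT) (@mulVg gT).
have braceS (x y z : gT) :
  circS x (dotS y z) = dotS (dotS (circS x y) (ginv dotS x)) (circS x z).
  rewrite /= /op -permM thV.
  (* Both sides lie in [N], the left one by [normN], and both send [x] to [x * z], so regularity
     makes them equal. The brace law is this equality evaluated at [x * y]. *)
  have <- : theta z ^ left_reg x = (theta x)^-1 * theta (x * z).
    apply: (injN x).
    - by rewrite memJ_norm ?thN //; apply: normN.
    - by rewrite groupM ?groupV.
    have thVx : (theta x)^-1 x = 1 by rewrite -{2}(th1 x) permK.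
    rewrite [RHS]permM thVx th1.
    by rewrite -[X in fun_of_perm _ X = _](mulg1 x) -(lamE x 1) permJ lamE th1.
  by rewrite -(lamE x y) permJ lamE.
exists (SkewBrace braceS); split=> //.
have rhoE x : rho_dot (SkewBrace braceS) x = (theta x)^-1.
  by apply/permP=> y; rewrite rho_dotE /= /op thV.
apply/setP=> p; apply/imsetP/idP=> [[x _ ->]|Np].
  by rewrite rhoE groupV.
(* Since [rho_dot] at x is the inverse of [theta x], the witness is the point to which the inverse
   of [p] sends 1. *)
by exists (p^-1 1) => //; rewrite rhoE thP ?groupV ?invgK.
Qed.

(** Conjugating right multiplication by y gives another right multiplication, so f(u . y) = f(u) . c
    with c independent of u; taking u to be the identity gives c = f(y). *)
Lemma rho_norm_morph (T : finType) (S : skew_brace T) (f : {perm T}) :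
    f \in 'N(rho_set S) -> f (gid (sdot S)) = gid (sdot S) ->
  {morph f : x y / sdot S x y}.
Proof.
move=> nSf f1 x y.
have /imsetP[z _ Dz]: rho_dot S (ginv (sdot S) y) ^ f \in rho_set S.
  by rewrite memJ_norm // imset_f.
have fE u : f (sdot S u y) = sdot S (f u) (ginv (sdot S) z).
  by rewrite -rho_dotE -Dz permJ rho_dotE ginvK.
rewrite fE; congr (sdot S _ _).
by rewrite -[y in RHS](gop1l (sdot S)) fE f1 gop1l.
Qed.

(** * Transport from Perm(X) to Perm(A), and the action of B on A *)

Section Psi.
Variables (gT : finGroupType) (A B : {group gT}).
Hypothesis sd : A ><| B = [set: gT].

Lemma psi_permE (mu : {perm lcoset_space B}) (a : subg_of A) :
  psi sd mu a = coset_a A (mu (a_coset B a)).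
Proof. exact: permE. Qed.

Lemma psi1 : psi sd 1 = 1.
Proof. by apply/permP=> a; rewrite psi_permE !perm1 a_cosetK. Qed.

Lemma psi_morph : {morph psi sd : mu mu' / mu * mu'}.
Proof.
by move=> mu mu'; apply/permP=> a; rewrite permM !psi_permE permM coset_aK.
Qed.

Lemma psi_group_set (M : {group {perm lcoset_space B}}) :
  group_set [set psi sd mu | mu in M].
Proof.
apply/group_setP; split=> [|_ _ /imsetP[mu Mmu ->] /imsetP[mu' Mmu' ->]].
  by rewrite -psi1 imset_f ?group1.
by rewrite -psi_morph imset_f ?groupM.
Qed.

Canonical psi_group M := Group (psi_group_set M).

Lemma psi_regular (M : {group {perm lcoset_space B}}) :
  regular_subgroup M -> regular_subgroup (psi_group M).
Proof.
move=> regM; split.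
  apply/imsetP; exists (1 : subg_of A); first by rewrite inE.
  apply/setP=> a; rewrite in_setT; symmetry; apply/orbitP.
  have [p Mp Dp] := regular_subgroup_onto (a_coset B (1 : subg_of A))
    (a_coset B a) regM.
  exists (psi sd p); first exact: imset_f.
  by rewrite /= apermE psi_permE Dp a_cosetK.
move=> a; apply/trivgP/subsetP=> _ /setIP[/imsetP[mu Mmu ->] /astab1P fix_a].
rewrite inE; suff ->: mu = 1 by rewrite psi1.
apply: (regular_subgroup_inj (y := a_coset B a) regM); rewrite ?group1 // perm1.
move: fix_a; rewrite /= apermE psi_permE => /(congr1 (a_coset B)).
by rewrite coset_aK.
Qed.

(** Under the bijection of A with X, [f] is translation by [g], so conjugating [psi sd mu] by [f]
    amounts to conjugating [mu] by that translation. This serves both for left translations of A and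
    for conjugations by B. *)
Lemma psi_normalised (M : {group {perm lcoset_space B}}) (g : gT)
    (f : {perm subg_of A}) :
    lcoset_reg B g \in 'N(M) ->
    (forall a, a_coset B (f a) = lcoset_reg B g (a_coset B a)) ->
  f \in 'N([set psi sd mu | mu in M]).
Proof.
move=> nMg fE; rewrite inE; apply/subsetP=> _ /imsetP[_ /imsetP[mu Mmu ->] ->].
suff ->: psi sd mu ^ f = psi sd (mu ^ lcoset_reg B g).
  by rewrite imset_f ?memJ_norm.
apply/permP=> b; have [a ->]: exists a, b = f a.
  by exists (f^-1 b); rewrite permKV.
rewrite permJ [RHS]psi_permE fE permJ.
by rewrite -{1}(coset_aK sd (mu _)) -fE (a_cosetK sd) psi_permE.
Qed.

(** The dot operation is componentwise, so right translation by ab is right translation by a on A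
    and by b on B, which is the shape of [nu]. *)
Lemma rho_set_brace_on_G (SA : skew_brace (subg_of A))
    (SB : skew_brace (subg_of B)) (act : brace_acts SA SB (@phi_conj gT A B))
    (M : {set {perm lcoset_space B}}) (N : {set {perm subg_of B}}) :
    rho_set SA = [set psi sd mu | mu in M] -> rho_set SB = N ->
  rho_set (brace_on_G sd act) = nu_set sd M N.
Proof.
move=> rhoA rhoB.
have rhoE g mu eta : rho_dot SA (ab_split A B g).1 = psi sd mu ->
    rho_dot SB (ab_split A B g).2 = eta ->
  rho_dot (brace_on_G sd act) g = nu sd mu eta.
  move=> Dmu Deta; apply/permP=> h.
  by rewrite rho_dotE /= permE /nu_fun -Dmu -Deta !rho_dotE ab_mulK.
apply/setP=> p; apply/imsetP/imset2P=> [[g _ ->]|[mu eta Mmu Neta ->]].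
  have: rho_dot SA (ab_split A B g).1 \in rho_set SA by apply: imset_f.
  rewrite rhoA => /imsetP[mu Mmu Dmu].
  exists mu (rho_dot SB (ab_split A B g).2) => //; last exact: rhoE.
  by rewrite -rhoB imset_f.
have: psi sd mu \in rho_set SA by rewrite rhoA imset_f.
case/imsetP=> a _ Da; move: Neta; rewrite -rhoB => /imsetP[b _ ->].
by exists (ab_mul (a, b)) => //; apply/esym/rhoE; rewrite ab_mulK.
Qed.

Lemma a_coset_left_reg (a b : subg_of A) :
  a_coset B (left_reg a b) = lcoset_reg B (sgval a) (a_coset B b).
Proof. by apply: val_inj; rewrite !permE /= lcosetM. Qed.

(** The coset absorbs the trailing inverse: b a b^-1 B = b a B. This turns normalisation of M by B
    into a statement on phi_b. *)
Lemma a_coset_phi_conj (b : subg_of B) (a : subg_of A) :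
  a_coset B (phi_conj b a) = lcoset_reg B (sgval b) (a_coset B a).
Proof.
apply: val_inj; rewrite permE /= (phi_conjE sd) !lcosetM.
by rewrite (lcoset_id (groupVr (subgP b))).
Qed.

Lemma phi_conj_inj (b : subg_of B) : injective (@phi_conj gT A B b).
Proof.
move=> a a' /(congr1 (a_coset B)); rewrite !a_coset_phi_conj.
by move/perm_inj/(can_inj (a_cosetK sd)).
Qed.

Lemma phi_conj_brace_acts (M : {group {perm lcoset_space B}})
    (SA : skew_brace (subg_of A)) (SB : skew_brace (subg_of B)) :
    normalised_by (@lcoset_reg gT B) M ->
    circ_given SA -> rho_set SA = [set psi sd mu | mu in M] ->
    circ_given SB ->
  brace_acts SA SB (@phi_conj gT A B).
Proof.
move=> normM cA rhoA cB; split=> [b c a|b|b x y|b].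
- apply: val_inj; rewrite /= !(phi_conjE sd) cB /=.
  by rewrite invMg !mulgA.
- exact/injF_bij/phi_conj_inj.
- by apply: val_inj; rewrite !cA /= !(phi_conjE sd) /= !mulgA mulgKV.
pose f := perm (@phi_conj_inj b).
have: f \in 'N(rho_set SA).
  rewrite rhoA; apply: (psi_normalised (normM (sgval b))) => a.
  by rewrite permE a_coset_phi_conj.
have fE a : f a = phi_conj b a by rewrite permE.
move/rho_norm_morph=> fM x y; rewrite -!fE; apply: fM.
(* What remains is that phi_b fixes the dot identity, which is the identity of the group A. *)
rewrite circ_given_gid // fE.
by apply: val_inj; rewrite /= (phi_conjE sd) /= mulg1 mulgV.
Qed.

End Psi.
End Groups.

(** * Galois descent and uniqueness of the Hopf-Galois structure *)

Section Descent.
Local Open Scope ring_scope.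

HB.instance Definition _ (F : fieldType) (U V : vectType F) (W : lmodType F)
    (beta : U -> V -> W) :=
  GRing.isLinear.Build F (tensor U V) W _ (tlift beta) (tlift_linear beta).

Lemma linear_tlift (F : fieldType) (U V : vectType F) (W Z : lmodType F)
    (f : {linear W -> Z}) (beta : U -> V -> W) (t : tensor U V) :
  f (tlift beta t) = tlift (fun x y => f (beta x y)) t.
Proof.
rewrite /tlift linear_sum; apply: eq_bigr => i _.
by rewrite linear_sum; apply: eq_bigr => j _; rewrite linearZ.
Qed.

Lemma eq_tlift (F : fieldType) (U V : vectType F) (W : lmodType F)
    (beta beta' : U -> V -> W) :
  (forall x y, beta x y = beta' x y) -> tlift beta =1 tlift beta'.
Proof.
by move=> eq_b t; apply: eq_bigr => i _; apply: eq_bigr => j _; rewrite eq_b.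
Qed.

Variables (K : fieldType) (L : splittingFieldType K).
Hypothesis galLK : galois 1%AS {:L}%VS.
Variables (gT : finGroupType) (sigma : gT -> gal_of {:L}%VS).
Hypothesis sigmaP : galois_ident sigma.

Let Tr (x : L) : L := \sum_g sigma g x.

Lemma sum_galois_ident (x : L) : Tr x = galTrace 1%AS {:L} x.
Proof.
have [inj_s im_s _] := sigmaP; rewrite /galTrace -im_s big_imset /=.
  by apply: eq_bigl => g; rewrite inE.
by move=> g h _ _; apply: inj_s.
Qed.

(** Independence of automorphisms, with all coefficients 1, gives [a] of nonzero trace; for nonzero
    [x] the choice y = a / x is then a contradiction. *)
Lemma trace_nondegenerate (x : L) : (forall y, Tr (y * x) = 0) -> x = 0.
Proof.
move=> Tr0; apply/eqP/negP=> /negP nz_x.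
have [a _ /eqP[]] := @gal_independent_contra K L {:L}%VS
  (mem ('Gal({:L} / 1%AS)%g)) (fun=> 1) 1%g (group1 _) (oner_neq0 _).
rewrite -[RHS](Tr0 (a / x)) divfK // sum_galois_ident.
by apply: eq_bigr => s _; rewrite mul1r.
Qed.

Lemma traceP (x : L) : exists a : K, Tr x = a%:A.
Proof.
have := @galTrace_fixedField K L 1%AS {:L}%AS x (memvf _).
rewrite (elimT galois_fixedField galLK) -sum_galois_ident => /vlineP[a ->].
by exists a.
Qed.

(* Galois descent: G-invariant vectors that are independent over K remain so
   over L, because applying trace (y * _) to a relation over L gives one over
   K. *)
Lemma invariant_free (P : finType) (lam : gT -> P -> P) (n : nat)
    (v : 'I_n -> {ffun P -> L}) (x : 'I_n -> L) :
    (forall g, bijective (lam g)) ->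
    (forall i g p, sigma g (v i p) = v i (lam g p)) ->
    (forall a : 'I_n -> K, \sum_i a i *: v i = 0 -> forall i, a i = 0) ->
    (forall p, \sum_i x i * v i p = 0) ->
  forall i, x i = 0.
Proof.
move=> bij_lam inv_v free_v rel_x i; apply: trace_nondegenerate => y.
have /fin_all_exists[a Da] (j : 'I_n) := traceP (y * x j).
rewrite Da (free_v a) ?scale0r //; apply/ffunP=> q.
rewrite sum_ffunE ffunE.
transitivity (\sum_g \sum_j sigma g (y * x j) * v j q).
  rewrite exchange_big; apply: eq_bigr => j _.
  by rewrite ffunE -mulr_suml -/(Tr _) Da -scalerAl mul1r.
apply: big1 => g _; have [lamV lamK lamVK] := bij_lam g.
(* By invariance [v j q] is [sigma g] of [v j (lamV q)], so the term is [sigma g] of [y] times the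
   relation at [lamV q]. *)
transitivity (sigma g (y * \sum_j x j * v j (lamV q))).
  rewrite mulr_sumr rmorph_sum; apply: eq_bigr => j _.
  by rewrite mulrA [RHS]rmorphM /= inv_v lamVK.
by rewrite rel_x mulr0 rmorph0.
Qed.

(** An element of the tensor square over K is thus determined by its L-valued function on pairs,
    which makes comultiplications comparable. *)
Lemma invariant_tlift_inj (H : vectType K) (P : finType) (lam : gT -> P -> P)
    (Phi : {linear H -> {ffun P -> L}}) :
    (forall g, bijective (lam g)) -> injective Phi ->
    (forall h g p, sigma g (Phi h p) = Phi h (lam g p)) ->
  injective (tlift (fun x y : H =>
    [ffun p : P * P => Phi x p.1 * Phi y p.2] : {ffun P * P -> L})).
Proof.
move=> bij_lam injPhi invPhi.
set J := tlift _.
suff J0 t : J t = 0 -> t = 0.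
  move=> s t eq_J; apply/eqP; rewrite -subr_eq0; apply/eqP/J0.
  by rewrite /J linearB /= -!/(J _) eq_J subrr.
pose e := vbasis {:H}.
have freePhi (a : 'I_(\dim {:H}) -> K) : \sum_i a i *: Phi e`_i = 0 ->
  forall i, a i = 0.
  move/freeP: (basis_free (vbasisP {:H})) => free_e rel; apply: free_e.
  apply: injPhi; rewrite linear0 linear_sum -[RHS]rel.
  by apply: eq_bigr => i _; rewrite linearZ.
move=> Jt0.
(* For fixed [q] the vanishing of [J t] is a relation over L among the [Phi e_i], with these sums as
   coefficients; descent removes the first factor, and independence over K then removes the
   second. *)
have row0 i q : \sum_j t i j *: Phi e`_j q = 0.
  move: i; apply: (@invariant_free P lam _ (fun i => Phi e`_i)) => //.
  move=> p; move/ffunP: Jt0 => /(_ (p, q)); rewrite !ffunE => Jt0.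
  rewrite -[RHS]Jt0 /J /tlift sum_ffunE; apply: eq_bigr => i _.
  rewrite sum_ffunE mulr_suml; apply: eq_bigr => j _.
  by rewrite !ffunE /= -scalerAl mulrC.
apply/matrixP=> i j; rewrite mxE; apply: (freePhi (t i)).
by apply/ffunP=> q; rewrite sum_ffunE ffunE -[RHS](row0 i q);
   apply: eq_bigr => k _; rewrite ffunE.
Qed.

(** [Phi] and [Phi'] are injective with the same image, the invariants of L[N], so the isomorphism
    is [Phi] followed by the inverse of [Phi']. *)
Lemma gp_full_iso (N : {set {perm gT}})
    (H H' : hopf_galois (L : fieldExtType K)) :
  gp_full sigma H N -> gp_full sigma H' N -> hopf_galois_iso H H'.
Proof.
move=> [Phi [injPhi imPhi [[Phi1 PhiM PhiD PhiE PhiS] PhiA]]].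
move=> [Phi' [injPhi' imPhi' [[Phi'1 Phi'M Phi'D Phi'E Phi'S] Phi'A]]].
have inv h : gp_invariant (fun g x => sigma g x) (@left_reg gT) N (Phi h).
  by apply/imPhi; exists h.
have inv' h : gp_invariant (fun g x => sigma g x) (@left_reg gT) N (Phi' h).
  by apply/imPhi'; exists h.
have ex_f h : exists h', Phi' h' == Phi h.
  by have /imPhi'[h' <-] := inv h; exists h'.
have ex_g h' : exists h, Phi h == Phi' h'.
  by have /imPhi[h <-] := inv' h'; exists h.
pose f h := xchoose (ex_f h); pose g h' := xchoose (ex_g h').
have fE h : Phi' (f h) = Phi h by apply/eqP/(xchooseP (ex_f h)).
have gE h : Phi (g h) = Phi' h by apply/eqP/(xchooseP (ex_g h)).
have f_linear : linear f.
  by move=> a h k; apply: injPhi'; rewrite linearP !fE linearP.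
have f_monoid : monoid_morphism f.
  split=> [|h k]; apply: injPhi'; first by rewrite fE Phi1 Phi'1.
  by rewrite fE PhiM Phi'M !fE.
pose fRM : {lrmorphism H -> H'} := HB.pack f
  (GRing.isLinear.Build _ _ _ _ f f_linear)
  (GRing.isMonoidMorphism.Build _ _ f f_monoid).
exists fRM; split.
- exists g => h; first by apply: injPhi; rewrite gE fE.
  by apply: injPhi'; rewrite fE gE.
(* As functions on pairs of permutations, both tensors become [Phi h] placed on the diagonal. *)
- move=> h /=; apply: (@invariant_tlift_inj _ _ (fun g p => (p ^ left_reg g)%g)
    Phi').
  + by move=> a; apply: injF_bij; apply: conjg_inj.
  + exact: injPhi'.
  + by move=> k a p; have [_ ->] := inv' k.
  rewrite Phi'D fE -PhiD linear_tlift; apply: eq_tlift => x y.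
  rewrite /= tliftE => [|z a u v|z a u v].
  + by apply/ffunP=> p; rewrite !ffunE !fE.
  + apply/ffunP=> p; rewrite !ffunE /= linearP !ffunE.
    by rewrite mulrDr scalerAr.
  apply/ffunP=> p; rewrite !ffunE /= linearP !ffunE.
  by rewrite mulrDl scalerAl.
(* Counits take values in K but are prescribed in L, so they are compared through the embedding of K
   in L. *)
- move=> h; apply: (fmorph_inj (in_alg L)); rewrite /= Phi'E PhiE.
  by apply: eq_bigr => eta _; rewrite fE.
- move=> h; apply: injPhi'; rewrite fE; apply/ffunP=> eta.
  by rewrite Phi'S PhiS fE.
move=> h t; rewrite [LHS]Phi'A [RHS]PhiA.
by apply: eq_bigr => eta _; rewrite fE.
Qed.

End Descent.

Theorem theorem5p3 (K : fieldType) (L : splittingFieldType K)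
    (galLK : galois 1%AS {:L}%VS)
    (gT : finGroupType) (sigma : gT -> gal_of {:L}%VS)
    (sigmaP : galois_ident sigma)
    (A B : {group gT}) (sd : (A ><| B = [set: gT])%g)
    (HX : hopf_galois (subvs_of (fixed_by sigma B) : fieldExtType K))
    (M : {group {perm lcoset_space B}})
    (Mreg : regular_subgroup M)
    (Mnorm : normalised_by (@lcoset_reg gT B) M)
    (HX_M : gp_fixed HX M)
    (HB : hopf_galois (fieldOver (fixed_by sigma B)))
    (N : {group {perm subg_of B}})
    (Nreg : regular_subgroup N)
    (Nnorm : normalised_by (@left_reg (subg_of B)) N)
    (HB_N : gp_over HB N)
    (SB : skew_brace (subg_of B))
    (SB_N : brace_of N SB) :
  exists SA : skew_brace (subg_of A),
    [/\ circ_given SA,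
        rho_set SA = [set psi sd mu | mu in M]
      & exists act : brace_acts SA SB (@phi_conj gT A B),
          let SG := brace_on_G sd act in
          [/\ circ_given SG,
              rho_set SG = nu_set sd M N
            & forall H H' : hopf_galois (L : fieldExtType K),
                hgs_of_brace sigma SG H -> hgs_induced sigma sd M N H' ->
                hopf_galois_iso H H']].
Proof.
have [cB rhoB] := SB_N.
have normA : normalised_by (@left_reg (subg_of A)) (psi_group sd M).
  move=> a; apply: (psi_normalised sd (Mnorm (sgval a))) => b.
  exact: a_coset_left_reg.
have [SA [cA rhoA]] := regular_subgroup_brace (psi_regular sd Mreg) normA.
exists SA; split=> //.
pose act := phi_conj_brace_acts Mnorm cA rhoA cB.
have rhoG := rho_set_brace_on_G act rhoA rhoB.
exists act; split=> // [|H H']; first exact: brace_on_G_circ.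
(* By [rhoG] both structures correspond to the same subgroup. *)
by rewrite /hgs_of_brace rhoG; apply: gp_full_iso.
Qed.
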